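(* Let $(M^n,g)$, $n\ge 3$, be a Riemannian manifold with Levi-Civita connection $\nabla$ and Ricci tensor $S$, let $P$ be a vector field on $M$ with $\|P\|=1$ and associated 1-form $\pi(X)=g(X,P)$, and let $\bar\nabla$ be the semi-symmetric metric connection determined by $\pi$. Suppose that $$S(Y,Z)=(n-2)g(Y,Z)-(n-2)\pi(Y)\pi(Z)$$ for all vector fields $Y,Z$. If $(M^n,\nabla)$ is Ricci symmetric, then $(M^n,\bar\nabla)$ is $\bar\nabla$-Ricci symmetric.
   Context: The semi-symmetric metric connection determined by $\pi$ is $\bar\nabla_XY=\nabla_XY+\pi(Y)X-g(X,Y)P$. Its curvature is $\bar R(X,Y)Z=\bar\nabla_X\bar\nabla_YZ-\bar\nabla_Y\bar\nabla_XZ-\bar\nabla_{[X,Y]}Z$ and its Ricci tensor is $\bar S(Y,Z)=\operatorname{tr}(X\mapsto \bar R(X,Y)Z)$, which in general is not symmetric; $S$ is defined in the same way from $\nabla$. The symmetrized Ricci tensor is $\hat S(Y,Z)=\frac12\{\bar S(Y,Z)+\bar S(Z,Y)\}$. $(M^n,\nabla)$ is Ricci symmetric if $\nabla S=0$. $(M^n,\bar\nabla)$ is $\bar\nabla$-Ricci symmetric if $\bar\nabla\hat S=0$. *)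

(* Defs.v *)
From mathcomp Require Import all_boot all_order all_algebra.
From mathcomp Require Import all_classical all_reals all_analysis.
Set Implicit Arguments.
Unset Strict Implicit.
Unset Printing Implicit Defensive.
Import Order.TTheory GRing.Theory Num.Theory.
Import numFieldNormedType.Exports.
Local Open Scope classical_set_scope.
Local Open Scope ring_scope.

(* [f] is C^k on the open set [U]: C^0 is continuity, and C^(k+1) means Frechet
   differentiable with all directional derivatives C^k. *)
Fixpoint Ck (R : realType) (V W : normedModType R) (k : nat) (U : set V)
    (f : V -> W) : Prop :=
  if k is k'.+1 then
    (forall x, U x -> differentiable f x) /\ (forall v, Ck k' U ('D_v f))
  else forall x, U x -> {for x, continuous f}.

Definition Cinfty (R : realType) (V W : normedModType R) (U : set V)
    (f : V -> W) : Prop := forall k, Ck k U f.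

(* [coord] and [inv] are total functions; [coord] is only meaningful on [dom],
   and [inv] on the image [coord @` dom]. *)
Record chart (R : realType) (n : nat) (T : topologicalType) := Chart {
  dom : set T;
  coord : T -> 'rV[R]_n;
  inv : 'rV[R]_n -> T;
  dom_open : open dom;
  codom_open : open (coord @` dom);
  coordK : forall p, dom p -> inv (coord p) = p;
  coord_cont : forall p, dom p -> {for p, continuous coord};
  inv_cont : forall x, (coord @` dom) x -> {for x, continuous inv} }.

Record manifold (R : realType) (n : nat) := Manifold {
  points :> topologicalType;
  points_hausdorff : hausdorff_space points;
  points_second_countable : @second_countable points;
  atlas : set (chart R n points);
  atlas_compat : forall c d, atlas c -> atlas d ->
    Cinfty (coord c @` (dom c `&` dom d)) (coord d \o inv c);
  chart_at : points -> chart R n points;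
  chart_at_atlas : forall p, atlas (chart_at p);
  chart_at_dom : forall p, dom (chart_at p) p }.

Definition smooth_fun (R : realType) (n : nat) (M : manifold R n) (U : set M)
    (f : M -> R) : Prop :=
  forall c, atlas c -> Cinfty (coord c @` (U `&` dom c)) (f \o inv c).

(* A tangent vector at [p] is represented by its components in the chart
   [chart_at p], so T_pM is ['rV[R]_n]. A vector field is a total function; one
   defined on an open set U only has arbitrary values outside U. *)
Definition vfield (R : realType) (n : nat) (M : manifold R n) : Type :=
  M -> 'rV[R]_n.

(* The components in the chart [c] of the tangent vector [v] at [p]: [v] is
   multiplied by the Jacobian at [p] of the change of coordinates from
   [chart_at p] to [c]. *)
Definition components (R : realType) (n : nat) (M : manifold R n)
    (c : chart R n M) (p : M) (v : 'rV[R]_n) : 'rV[R]_n :=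
  'D_v (coord c \o inv (chart_at p)) (coord (chart_at p) p).

Definition local_rep (R : realType) (n : nat) (M : manifold R n)
    (c : chart R n M) (X : vfield M) (x : 'rV[R]_n) : 'rV[R]_n :=
  components c (inv c x) (X (inv c x)).

Definition smooth_field (R : realType) (n : nat) (M : manifold R n)
    (U : set M) (X : vfield M) : Prop :=
  forall c, atlas c -> Cinfty (coord c @` (U `&` dom c)) (local_rep c X).

(* The function X f. *)
Definition act (R : realType) (n : nat) (M : manifold R n) (X : vfield M)
    (f : M -> R) : M -> R :=
  fun p => 'D_(X p) (f \o inv (chart_at p)) (coord (chart_at p) p).

(* [X, Y]^k = X^i d_i Y^k - Y^i d_i X^k, computed at [p] in [chart_at p]. *)
Definition lie (R : realType) (n : nat) (M : manifold R n) (X Y : vfield M) :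
    vfield M :=
  fun p => let x := coord (chart_at p) p in
    'D_(X p) (local_rep (chart_at p) Y) x
      - 'D_(Y p) (local_rep (chart_at p) X) x.

(* The local vector field with value [v] at [p] and with constant components
   in [chart_at p]; smooth on [dom (chart_at p)]. *)
Definition extend (R : realType) (n : nat) (M : manifold R n) (p : M)
    (v : 'rV[R]_n) : vfield M :=
  fun q => let c := chart_at p in
    'D_v (coord (chart_at q) \o inv c) (coord c q).

Record riemannian_metric (R : realType) (n : nat) (M : manifold R n) :=
  RiemannianMetric {
    metric :> forall p : M, 'rV[R]_n -> 'rV[R]_n -> R;
    metric_sym : forall p u v, metric p u v = metric p v u;
    metric_linear : forall p a u v w,
      metric p (a *: u + v) w = a * metric p u w + metric p v w;
    metric_pos : forall p v, v != 0 -> 0 < metric p v v;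
    metric_smooth : forall (U : set M) (X Y : vfield M), open U ->
      smooth_field U X -> smooth_field U Y ->
      smooth_fun U (fun p => metric p (X p) (Y p)) }.

Definition inner (R : realType) (n : nat) (M : manifold R n)
    (g : riemannian_metric M) (X Y : vfield M) : M -> R :=
  fun p => g p (X p) (Y p).

(* [D X Y] is the covariant derivative of Y along X. The operator acts on vector
   fields over arbitrary open sets U. Over U, only the values of X and Y on U
   matter: if X is replaced by X + f W, or Y by Y + f W, with f = 0 on U and
   f = 1 elsewhere, then the axioms over U show that D X Y is unchanged on U. *)
Record affine_connection (R : realType) (n : nat) (M : manifold R n)
    (D : vfield M -> vfield M -> vfield M) : Prop := AffineConnection {
  conn_smooth : forall (U : set M) X Y, open U ->
    smooth_field U X -> smooth_field U Y -> smooth_field U (D X Y);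
  conn_addl : forall (U : set M) X X' Y, open U ->
    smooth_field U X -> smooth_field U X' -> smooth_field U Y ->
    forall p, U p -> D (fun q => X q + X' q) Y p = D X Y p + D X' Y p;
  conn_scalel : forall (U : set M) f X Y, open U ->
    smooth_fun U f -> smooth_field U X -> smooth_field U Y ->
    forall p, U p -> D (fun q => f q *: X q) Y p = f p *: D X Y p;
  conn_addr : forall (U : set M) X Y Y', open U ->
    smooth_field U X -> smooth_field U Y -> smooth_field U Y' ->
    forall p, U p -> D X (fun q => Y q + Y' q) p = D X Y p + D X Y' p;
  conn_leibniz : forall (U : set M) f X Y, open U ->
    smooth_fun U f -> smooth_field U X -> smooth_field U Y ->
    forall p, U p ->
    D X (fun q => f q *: Y q) p = act X f p *: Y p + f p *: D X Y p }.

Definition metric_connection (R : realType) (n : nat) (M : manifold R n)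
    (g : riemannian_metric M) (D : vfield M -> vfield M -> vfield M) : Prop :=
  forall (U : set M) X Y Z, open U ->
    smooth_field U X -> smooth_field U Y -> smooth_field U Z ->
    forall p, U p ->
    act X (inner g Y Z) p = inner g (D X Y) Z p + inner g Y (D X Z) p.

Definition torsion_free (R : realType) (n : nat) (M : manifold R n)
    (D : vfield M -> vfield M -> vfield M) : Prop :=
  forall (U : set M) X Y, open U -> smooth_field U X -> smooth_field U Y ->
    forall p, U p -> D X Y p - D Y X p = lie X Y p.

Definition levi_civita (R : realType) (n : nat) (M : manifold R n)
    (g : riemannian_metric M) (D : vfield M -> vfield M -> vfield M) : Prop :=
  [/\ affine_connection D, metric_connection g D & torsion_free D].

(* The connection determined by the 1-form pi = g(-, P). *)
Definition semi_symmetric (R : realType) (n : nat) (M : manifold R n)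
    (g : riemannian_metric M) (D : vfield M -> vfield M -> vfield M)
    (P : vfield M) : vfield M -> vfield M -> vfield M :=
  fun X Y p => D X Y p + inner g Y P p *: X p - inner g X Y p *: P p.

Definition curvature (R : realType) (n : nat) (M : manifold R n)
    (D : vfield M -> vfield M -> vfield M) (X Y Z : vfield M) : vfield M :=
  fun p => D X (D Y Z) p - D Y (D X Z) p - D (lie X Y) Z p.

(* The trace of the endomorphism v |-> R(v, Y)Z of T_pM. As R is tensorial in its
   first argument, any local extension of v to a vector field will do. *)
Definition ricci (R : realType) (n : nat) (M : manifold R n)
    (D : vfield M -> vfield M -> vfield M) (Y Z : vfield M) : M -> R :=
  fun p => \tr (lin1_mx (fun v => curvature D (extend p v) Y Z p)).

Definition sym_ricci (R : realType) (n : nat) (M : manifold R n)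
    (D : vfield M -> vfield M -> vfield M) (Y Z : vfield M) : M -> R :=
  fun p => 2^-1 * (ricci D Y Z p + ricci D Z Y p).

(* (D_X T)(Y, Z) for a (0,2)-tensor field T. *)
Definition cov_deriv2 (R : realType) (n : nat) (M : manifold R n)
    (D : vfield M -> vfield M -> vfield M)
    (T : vfield M -> vfield M -> M -> R) (X Y Z : vfield M) : M -> R :=
  fun p => act X (T Y Z) p - T (D X Y) Z p - T Y (D X Z) p.

Definition parallel2 (R : realType) (n : nat) (M : manifold R n)
    (D : vfield M -> vfield M -> vfield M)
    (T : vfield M -> vfield M -> M -> R) : Prop :=
  forall (U : set M) X Y Z, open U ->
    smooth_field U X -> smooth_field U Y -> smooth_field U Z ->
    forall p, U p -> cov_deriv2 D T X Y Z p = 0.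

Definition ricci_symmetric (R : realType) (n : nat) (M : manifold R n)
    (D : vfield M -> vfield M -> vfield M) : Prop :=
  parallel2 D (ricci D).

Definition sym_ricci_symmetric (R : realType) (n : nat) (M : manifold R n)
    (D : vfield M -> vfield M -> vfield M) : Prop :=
  parallel2 D (sym_ricci D).

(* Main.v *)
(* Write pi for g(-, P). Since g and S are parallel for nabla, and S(-, P) = 0,
   S(Y, nabla_X P) = 0 for all Y; as nabla_X P is orthogonal to P, this reads
   (n-2) g(Y, nabla_X P) = 0, so P is parallel. For a parallel unit field P,
     Rbar(X,Y)Z = R(X,Y)Z + (pi(Y)pi(Z) - g(Y,Z)) X - (pi(X)pi(Z) - g(X,Z)) Y
                  + (g(Y,Z) pi(X) - g(X,Z) pi(Y)) P,
   whose trace over X is Sbar = S - (n-2)(g - pi (x) pi) = 0. Hence the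
   symmetrized Ricci tensor of the semi-symmetric connection vanishes. *)
From HB Require Import structures.
From mathcomp Require Import all_boot all_order all_algebra.
From mathcomp Require Import ring.
From mathcomp Require Import all_classical all_reals all_analysis.
Require Import Defs.
Import Order.TTheory GRing.Theory Num.Theory.
Import numFieldNormedType.Exports.
Local Open Scope classical_set_scope.
Local Open Scope ring_scope.

Set Implicit Arguments.
Unset Strict Implicit.
Unset Printing Implicit Defensive.

(** * Locality of differentiability and the product rule for scalar multiplication *)

Section Calculus.
Variables (R : realType) (V W : normedModType R).

(** The values of [f] and [g] agree near [x], so the first-order expansion of [f] at [x] is also one
    for [g]; uniqueness of the differential then gives ['d g x = 'd f x]. *)
Lemma near_eq_differentiable (f g : V -> W) (x : V) :
  (\near x, f x = g x) -> differentiable f x -> differentiable g x.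
Proof.
move=> fg df.
have [dfc /eqaddoP dfo] := (diff_locallyP x f).1 df.
have hd : g \o shift x = cst (g x) + 'd f x +o_ (0 : V) id.
  apply/eqaddoP => _ /posnumP[e].
  have fg0 : \forall h \near (0 : V), f (h + x) = g (h + x).
    by move: fg; rewrite (near_shift 0) subr0.
  near=> h; rewrite !fctE /= -(nbhs_singleton fg).
  have <- : f (h + x) = g (h + x) by near: h.
  by near: h; exact: dfo.
by apply/diff_locallyP; rewrite (diff_unique dfc hd).
Unshelve. all: by end_near. Qed.

(** Registered as a bilinear instance, scaling inherits the differential of continuous bilinear
    maps, from which the product rule follows. *)
Lemma scale_bilinear : bilinear_for
    (GRing.Scale.Law.clone _ _ *:%R _) (GRing.Scale.Law.clone _ _ *:%R _)
    (@GRing.scale R W).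
Proof.
split=> [u'|u] a x y /=.
- by rewrite scalerDl scalerA.
- by rewrite scalerDr !scalerA mulrC.
Qed.

HB.instance Definition _ :=
  bilinear_isBilinear.Build R R W W _ _ (@GRing.scale R W) scale_bilinear.

Lemma differentiable_scale (f : V -> R) (g : V -> W) x :
  differentiable f x -> differentiable g x ->
  differentiable (fun y => f y *: g y) x.
Proof.
move=> df dg.
apply: (@differentiable_comp _ _ _ _ (fun y => (f y, g y))
  (fun p => p.1 *: p.2)).
  exact: differentiable_pair.
by apply: differentiable_bilin => p; exact: scale_continuous.
Qed.

Lemma derive_scale (f : V -> R) (g : V -> W) x v :
  differentiable f x -> differentiable g x ->
  'D_v (fun y => f y *: g y) x = 'D_v f x *: g x + f x *: 'D_v g x.
Proof.
move=> df dg.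
have h : continuous (fun p : R * W => p.1 *: p.2).
  by move=> p; exact: scale_continuous.
rewrite !deriveE //; last exact: differentiable_scale.
rewrite (@diff_comp _ _ _ _ (fun y => (f y, g y))
  (fun p => p.1 *: p.2)) /=.
- by rewrite diff_bilin //= diff_pair //= addrC.
- exact: differentiable_pair.
- exact: differentiable_bilin.
Qed.

End Calculus.

(** * Closure properties of C^k maps on open sets *)

Section SmoothFunctions.
Variable R : realType.
Implicit Types V W : normedModType R.

Lemma Ck_sub V W k (A B : set V) (f : V -> W) :
  A `<=` B -> Ck k B f -> Ck k A f.
Proof.
move=> AB; elim: k f => [|k IH] f /=; first by move=> h x /AB; exact: h.
by move=> [h1 h2]; split=> [x /AB|v]; [exact: h1|exact/IH].
Qed.

Lemma Ck_pred V W k (U : set V) (f : V -> W) : Ck k.+1 U f -> Ck k U f.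
Proof.
elim: k f => [|k IH] f [h1 h2].
  by move=> x /h1/differentiable_continuous.
by split=> // v; exact/IH/h2.
Qed.

Lemma open_near_eq V W (U : set V) (f g : V -> W) x : open U -> U x ->
  (forall x, U x -> f x = g x) -> \near x, f x = g x.
Proof. by move=> oU Ux fg; near do apply: fg; exact: open_nbhs_nbhs.
Unshelve. all: by end_near. Qed.

(** As [U] is open, equality on [U] is equality of germs at its points, and germs determine
    continuity and derivatives. This allows a derivative to be replaced by a formula valid on [U]
    only. *)
Lemma Ck_ext V W k (U : set V) (f g : V -> W) : open U ->
  (forall x, U x -> f x = g x) -> Ck k U f -> Ck k U g.
Proof.
move=> oU; elim: k f g => [|k IH] f g fg /=.
  move=> cf x Ux; rewrite /prop_for /continuous_at -(fg _ Ux).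
  apply: cvg_trans (cf _ Ux); apply: near_eq_cvg; exact: open_near_eq Ux fg.
move=> [df Df]; split=> [x Ux|v].
  exact: near_eq_differentiable (open_near_eq oU Ux fg) (df _ Ux).
apply: (IH ('D_v f)) => // x Ux.
exact/near_eq_derive/(open_near_eq oU Ux fg).
Qed.

Lemma Ck_cst V W k (U : set V) (a : W) : open U -> Ck k U (cst a).
Proof.
move=> oU; elim: k a => [|k IH] a /=; first by move=> x _; exact: cst_continuous.
split=> [x _|v]; first exact: differentiable_cst.
by apply: (Ck_ext oU _ (IH 0)) => x _; rewrite derive_cst.
Qed.

Lemma Ck_add V W k (U : set V) (f g : V -> W) : open U ->
  Ck k U f -> Ck k U g -> Ck k U (fun x => f x + g x).
Proof.
move=> oU; elim: k f g => [|k IH] f g /=.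
  by move=> cf cg x Ux; apply: continuousD; [exact: cf|exact: cg].
move=> [df Df] [dg Dg]; split=> [x Ux|v].
  by apply: differentiableD; [exact: df|exact: dg].
apply: (Ck_ext oU _ (IH _ _ (Df v) (Dg v))) => x Ux.
by rewrite -deriveD //; apply: diff_derivable; [exact: df|exact: dg].
Qed.

Lemma Ck_sum V W k (U : set V) n (f : 'I_n -> V -> W) : open U ->
  (forall i, Ck k U (f i)) -> Ck k U (fun x => \sum_(i < n) f i x).
Proof.
move=> oU cf; rewrite (_ : (fun x => _) = \sum_(i < n) f i); last first.
  by apply/funext => x; rewrite fct_sumE.
elim/big_ind: _ => //; first exact: (Ck_cst k 0 oU).
by move=> g h; exact: Ck_add.
Qed.

(** Each term of the product rule keeps one factor undifferentiated; [Ck_pred] lowers the class of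
    that factor so that the induction hypothesis applies. *)
Lemma Ck_scale V W k (U : set V) (f : V -> R) (g : V -> W) : open U ->
  Ck k U f -> Ck k U g -> Ck k U (fun x => f x *: g x).
Proof.
move=> oU; elim: k f g => [|k IH] f g.
  by move=> cf cg x Ux; apply: continuousZ; [exact: cf|exact: cg].
move=> cf cg; have [df Df] := cf; have [dg Dg] := cg; split=> [x Ux|v].
  by apply: differentiable_scale; [exact: df|exact: dg].
apply: (Ck_ext oU _ (Ck_add oU (IH _ _ (Df v) (Ck_pred cg))
  (IH _ _ (Ck_pred cf) (Dg v)))).
by move=> x Ux; rewrite derive_scale //; [exact: df|exact: dg].
Qed.

Lemma derive_coord V m n (f : V -> 'M[R]_(m, n)) x v i j :
  differentiable f x -> 'D_v (fun y => f y i j) x = 'D_v f x i j.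
Proof. by move=> df; rewrite derive_mx ?mxE //; exact: diff_derivable. Qed.

Lemma Ck_coord V m n k (U : set V) (f : V -> 'M[R]_(m, n)) i j : open U ->
  Ck k U f -> Ck k U (fun x => f x i j).
Proof.
move=> oU; elim: k f => [|k IH] f /=.
  move=> cf x Ux; apply: (@continuous_comp _ _ _ f (fun N => N i j)); first exact: cf.
  exact: coord_continuous.
move=> [df Df]; split=> [x Ux|v].
  apply: (@differentiable_comp _ _ _ _ f (fun N => N i j)); first exact: df.
  exact: differentiable_coord.
apply: (Ck_ext oU _ (IH _ (Df v))) => x Ux.
by rewrite derive_coord //; exact: df.
Qed.

Lemma derive_comp V W V' (f : V -> W) (g : W -> V') x v :
  differentiable f x -> differentiable g (f x) ->
  'D_v (g \o f) x = 'D_('D_v f x) g (f x).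
Proof.
move=> df dg; rewrite (deriveE _ (differentiable_comp df dg)) diff_comp //=.
by rewrite (deriveE _ dg) (deriveE _ df).
Qed.

Lemma derive_delta n W (f : 'rV[R]_n -> W) x v : differentiable f x ->
  'D_v f x = \sum_(i < n) v 0 i *: 'D_(delta_mx 0 i) f x.
Proof.
move=> df; rewrite deriveE // {1}(row_sum_delta v) linear_sum.
by apply: eq_bigr => i _; rewrite linearZ deriveE.
Qed.

(** In the chain rule the direction ['D_v f x] varies with [x], whereas [Ck] speaks of fixed
    directions. Expanding it in the standard basis leaves products of coordinates of ['D_v f] with
    partial derivatives of [g] composed with [f]. *)
Lemma Ck_comp n V W k (U : set V) (U' : set 'rV[R]_n)
    (f : V -> 'rV[R]_n) (g : 'rV[R]_n -> W) : open U -> open U' ->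
  (forall x, U x -> U' (f x)) -> Ck k U f -> Ck k U' g -> Ck k U (g \o f).
Proof.
move=> oU oU' ff'; elim: k g => [|k IH] g cf cg.
  by move=> x Ux; apply: continuous_comp; [exact: cf|exact/cg/ff'].
have [df Df] := cf; have [dg Dg] := cg; split=> [x Ux|v].
  by apply: differentiable_comp; [exact: df|exact/dg/ff'].
have h := Ck_sum oU (fun i => Ck_scale oU (Ck_coord 0 i oU (Df v))
  (IH ('D_(delta_mx 0 i) g) (Ck_pred cf) (Dg _))).
apply: (Ck_ext oU _ h) => x Ux /=.
have dfx := df _ Ux; have dgx := dg _ (ff' _ Ux).
by rewrite (derive_comp _ dfx dgx) (derive_delta _ dgx).
Qed.

End SmoothFunctions.

(** * Changes of coordinates and smooth vector fields *)

Section Charts.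
Variables (R : realType) (n : nat) (M : manifold R n).
Implicit Types (c d : chart R n M) (U : set M) (X Y : vfield M) (f : M -> R).
Implicit Types (p : M) (v : 'rV[R]_n).

Lemma chart_image c U x : (coord c @` (U `&` dom c)) x ->
  [/\ U (inv c x), dom c (inv c x) & coord c (inv c x) = x].
Proof. by move=> [p [Up cp] <-]; rewrite coordK. Qed.

Lemma inv_near c U p : open U -> U p -> dom c p ->
  \forall x \near coord c p, U (inv c x).
Proof.
move=> oU Up cp.
have /inv_cont : (coord c @` dom c) (coord c p) by exists p.
by apply; rewrite coordK //; exact: open_nbhs_nbhs.
Qed.

(** A point near [coord c p] has the form [coord c q] because the image of [dom c] is open, and [q],
    its image under the continuous [inv c], stays in [U]. *)
Lemma chart_image_open c U : open U -> open (coord c @` (U `&` dom c)).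
Proof.
move=> oU; rewrite openE => x [p [Up cp] <-].
have Uy := inv_near oU Up cp.
have cy : \forall y \near coord c p, (coord c @` dom c) y.
  by apply: open_nbhs_nbhs; split; [exact: codom_open|exists p].
rewrite /interior; near=> y.
have [q cq qy] : (coord c @` dom c) y by near: y.
exists q => //; split=> //; rewrite -(coordK cq) qy; near: y; exact: Uy.
Unshelve. all: by end_near. Qed.

Lemma differentiable_transition c d p : atlas c -> atlas d ->
  dom c p -> dom d p -> differentiable (coord d \o inv c) (coord c p).
Proof.
move=> ac ad cp dp; have [h _] := atlas_compat ac ad 1%N.
by apply: h; exists p.
Qed.

Lemma componentsE c p v : atlas c -> dom c p ->
  components c p v = 'd (coord c \o inv (chart_at p)) (coord (chart_at p) p) v.
Proof.
move=> ac cp; rewrite /components deriveE //.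
by apply: differentiable_transition => //; [exact: chart_at_atlas|exact: chart_at_dom].
Qed.

(** Chain rule through the chart at [p]: near [coord c p] the two changes of coordinates compose to
    the direct one from [c] to [d]. *)
Lemma components_transition c d p v : atlas c -> atlas d -> dom c p -> dom d p ->
  components d p ('D_v (coord (chart_at p) \o inv c) (coord c p)) =
  'D_v (coord d \o inv c) (coord c p).
Proof.
move=> ac ad cp dp; set b := chart_at p.
have ab : atlas b by exact: chart_at_atlas.
have bp : dom b p by exact: chart_at_dom.
rewrite /components -/b -[in coord b p](coordK cp).
rewrite -[coord b _]/((coord b \o inv c) _) -derive_comp.
- apply: near_eq_derive; near=> x.
  have bx : dom b (inv c x) by near: x; apply: inv_near => //; exact: dom_open.
  by rewrite /= coordK.
- exact: differentiable_transition.
- by rewrite /= coordK //; exact: differentiable_transition.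
Unshelve. all: by end_near. Qed.

Lemma smooth_field_sub U U' X : U `<=` U' -> smooth_field U' X -> smooth_field U X.
Proof.
move=> UU' sX c ac k; apply: Ck_sub (sX c ac k).
by apply: image_subset => p [/UU' ? ?].
Qed.

Lemma smooth_fieldD U X Y : open U -> smooth_field U X -> smooth_field U Y ->
  smooth_field U (fun p => X p + Y p).
Proof.
move=> oU sX sY c ac k.
apply: (Ck_ext (chart_image_open oU) _
  (Ck_add (chart_image_open oU) (sX c ac k) (sY c ac k))) => x /chart_image[_ cx _].
by rewrite /local_rep !componentsE // linearD.
Qed.

Lemma smooth_fieldZ U f X : open U -> smooth_fun U f -> smooth_field U X ->
  smooth_field U (fun p => f p *: X p).
Proof.
move=> oU sf sX c ac k.
apply: (Ck_ext (chart_image_open oU) _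
  (Ck_scale (chart_image_open oU) (sf c ac k) (sX c ac k))) => x /chart_image[_ cx _].
by rewrite /local_rep !componentsE // linearZ.
Qed.

Lemma smooth_funN U f : open U -> smooth_fun U f -> smooth_fun U (fun p => - f p).
Proof.
move=> oU sf c ac k; have oc := chart_image_open (c := c) oU.
apply: (Ck_ext oc _ (Ck_scale oc (Ck_cst k (-1 : R) oc) (sf c ac k))) => x _.
by rewrite /= /cst scaleN1r.
Qed.

(** In a chart [d], the field is the derivative along [v] of the transition from [c] to [d],
    precomposed with the transition from [d] to [c]. *)
Lemma smooth_extend p v : smooth_field (dom (chart_at p)) (extend p v).
Proof.
move=> d ad k; set c := chart_at p.
have ac : atlas c by exact: chart_at_atlas.
have oc := chart_image_open (c := d) (dom_open c).
have oc' := chart_image_open (c := c) (dom_open d).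
rewrite setIC in oc'.
(* One order more than [k], since this transition is differentiated once. *)
have [_ h] := atlas_compat ac ad k.+1.
have h' := atlas_compat ad ac k; rewrite setIC in h'.
apply: (Ck_ext oc _ (Ck_comp oc oc' _ h' (h v))).
  move=> x /chart_image[cx dx xE] /=.
  rewrite /local_rep /extend -/c.
  by rewrite components_transition.
move=> x /chart_image[cx dx xE] /=.
by exists (inv d x).
Qed.

(** At [p] both charts coincide, and [coord c \o inv c] is the identity near [coord c p]. *)
Lemma extend_at p v : extend p v p = v.
Proof.
rewrite /extend -[RHS](derive_id (coord (chart_at p) p)).
apply: near_eq_derive.
have := chart_image_open (c := chart_at p) openT; rewrite setTI => oc.
near=> x.
have [q cq <-] : (coord (chart_at p) @` dom (chart_at p)) x.
  near: x; apply: open_nbhs_nbhs; split => //; exists p => //; exact: chart_at_dom.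
by rewrite /= coordK.
Unshelve. all: by end_near. Qed.

Lemma act_cst U X f a p : open U -> U p -> (forall q, U q -> f q = a) ->
  act X f p = 0.
Proof.
move=> oU Up fa; rewrite /act -[RHS](derive_cst a (coord (chart_at p) p) (X p)).
apply: near_eq_derive; near=> x; apply: fa; near: x.
by apply: inv_near => //; exact: chart_at_dom.
Unshelve. all: by end_near. Qed.

End Charts.

(** * Bilinear algebra of the metric on a tangent space *)

Section MetricAlgebra.
Variables (R : realType) (n : nat) (M : manifold R n) (g : riemannian_metric M).
Implicit Types (p : M) (u v w : 'rV[R]_n).

Lemma metricDl p u v w : g p (u + v) w = g p u w + g p v w.
Proof. by rewrite -[u]scale1r metric_linear mul1r scale1r. Qed.

Lemma metric0l p w : g p 0 w = 0.
Proof. by apply: (addrI (g p 0 w)); rewrite -metricDl !addr0. Qed.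

Lemma metricZl p a u w : g p (a *: u) w = a * g p u w.
Proof. by rewrite -[_ *: u]addr0 metric_linear metric0l addr0. Qed.

Lemma metricBl p u v w : g p (u - v) w = g p u w - g p v w.
Proof. by rewrite metricDl -scaleN1r metricZl mulN1r. Qed.

Lemma metricDr p u v w : g p w (u + v) = g p w u + g p w v.
Proof. by rewrite !(metric_sym g p w) metricDl. Qed.

Lemma metricZr p a u w : g p w (a *: u) = a * g p w u.
Proof. by rewrite !(metric_sym g p w) metricZl. Qed.

Lemma metricBr p u v w : g p w (u - v) = g p w u - g p w v.
Proof. by rewrite !(metric_sym g p w) metricBl. Qed.

Lemma metric_eq0 p v : g p v v = 0 -> v = 0.
Proof.
by move=> gv; apply/eqP/negPn/negP => /(metric_pos g p); rewrite gv ltxx.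
Qed.

(** This is the trace of the rank-one endomorphism sending [u] to [g(u, w) v], taken in the standard
    basis, which need not be orthonormal for [g]. *)
Lemma metric_trace p v w :
  \sum_(i < n) g p (delta_mx 0 i) w * v 0 i = g p v w.
Proof.
rewrite [in RHS](row_sum_delta v).
elim/big_rec2: _ => [|i a b _ ->]; first by rewrite metric0l.
by rewrite metricDl metricZl mulrC.
Qed.

End MetricAlgebra.

Lemma ricciE (R : realType) (n : nat) (M : manifold R n)
    (D : vfield M -> vfield M -> vfield M) (Y Z : vfield M) p :
  ricci D Y Z p =
  \sum_(i < n) curvature D (extend p (delta_mx 0 i)) Y Z p 0 i.
Proof. by apply: eq_bigr => i _; rewrite mxE. Qed.

(** * The semi-symmetric connection of a unit field *)

Section SemiSymmetric.
Variables (R : realType) (n : nat) (M : manifold R n) (g : riemannian_metric M).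
Variables (D : vfield M -> vfield M -> vfield M) (P : vfield M).
Hypothesis lcD : levi_civita g D.
Hypothesis smP : smooth_field [set: M] P.
Hypothesis unitP : forall p, inner g P P p = 1.
Implicit Types (U : set M) (X Y Z : vfield M).

Lemma smooth_unit U : smooth_field U P.
Proof. exact: smooth_field_sub smP. Qed.

(** Differentiating [g(P, P) = 1] along [X] gives [2 g(D_X P, P) = 0]. *)
Lemma unit_derivative_orthogonal U X p : open U -> smooth_field U X -> U p ->
  inner g (D X P) P p = 0.
Proof.
move=> oU sX Up; have [_ mD _] := lcD.
have := mD _ _ _ _ oU sX (smooth_unit U) (smooth_unit U) _ Up.
rewrite (act_cst X oU Up (fun q _ => unitP q)) /inner [g p (P p) _]metric_sym => /esym/eqP.
by rewrite -mulr2n mulrn_eq0 /= => /eqP.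
Qed.

Notation Dbar := (semi_symmetric g D P).

Lemma smooth_semi_symmetric U Y Z : open U ->
  smooth_field U Y -> smooth_field U Z -> smooth_field U (Dbar Y Z).
Proof.
move=> oU sY sZ; have [aD _ _] := lcD; have sP := smooth_unit U.
have sYZ : smooth_fun U (inner g Y Z) by exact: (metric_smooth g oU).
have sZP : smooth_fun U (inner g Z P) by exact: (metric_smooth g oU).
have -> : Dbar Y Z = fun q => (D Y Z q + inner g Z P q *: Y q)
    + (- inner g Y Z q) *: P q.
  by apply/funext => q; rewrite /semi_symmetric scaleNr.
apply: (smooth_fieldD oU) (smooth_fieldZ oU (smooth_funN oU sYZ) sP).
exact: smooth_fieldD oU (conn_smooth aD oU sY sZ) (smooth_fieldZ oU sZP sY).
Qed.

(** * Its curvature and Ricci tensor when the unit field is parallel *)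

Hypothesis parP : forall U X p, open U -> smooth_field U X -> U p -> D X P p = 0.

Lemma conn_semi_symmetric U X Y Z p : open U ->
  smooth_field U X -> smooth_field U Y -> smooth_field U Z -> U p ->
  D X (Dbar Y Z) p = D X (D Y Z) p
    + (inner g (D X Z) P p *: Y p + inner g Z P p *: D X Y p)
    - (inner g (D X Y) Z p + inner g Y (D X Z) p) *: P p.
Proof.
move=> oU sX sY sZ Up; have [aD mD _] := lcD; have sP := smooth_unit U.
have sYZ : smooth_fun U (inner g Y Z) by exact: (metric_smooth g oU).
have sZP : smooth_fun U (inner g Z P) by exact: (metric_smooth g oU).
have sDYZ : smooth_field U (D Y Z).
  exact: (conn_smooth aD oU sY sZ).
have sZPY : smooth_field U (fun q => inner g Z P q *: Y q).
  exact: (smooth_fieldZ oU sZP sY).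
have sYZP : smooth_field U (fun q => inner g Y Z q *: P q).
  exact: (smooth_fieldZ oU sYZ sP).
have sA := smooth_semi_symmetric oU sY sZ.
(* Additivity is stated for sums: adding [g(Y, Z) P] to [Dbar Y Z] removes the minus sign, and its
   derivative is cancelled at the end. *)
have := conn_addr aD oU sX sA sYZP Up.
have -> : (fun q => Dbar Y Z q + inner g Y Z q *: P q) =
    fun q => D Y Z q + inner g Z P q *: Y q.
  by apply/funext => q; rewrite /semi_symmetric subrK.
rewrite (conn_addr aD oU sX sDYZ sZPY Up) (conn_leibniz aD oU sZP sX sY Up).
rewrite (conn_leibniz aD oU sYZ sX sP Up) (parP oU sX Up) scaler0 addr0.
rewrite (mD _ _ _ _ oU sX sZ sP _ Up) (mD _ _ _ _ oU sX sY sZ _ Up).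
rewrite {2}/inner (parP oU sX Up) metric_sym metric0l addr0 => ->.
by rewrite addrK.
Qed.

Lemma curvature_semi_symmetric U X Y Z p : open U ->
  smooth_field U X -> smooth_field U Y -> smooth_field U Z -> U p ->
  curvature Dbar X Y Z p = curvature D X Y Z p
    + (inner g Y P p * inner g Z P p - inner g Y Z p) *: X p
    - (inner g X P p * inner g Z P p - inner g X Z p) *: Y p
    + (inner g Y Z p * inner g X P p - inner g X Z p * inner g Y P p) *: P p.
Proof.
move=> oU sX sY sZ Up; have [_ _ tD] := lcD.
(* Writing the bracket as [D_X Y - D_Y X] makes all first-order terms outside [curvature D]
   cancel. *)
have lieE := tD _ _ _ oU sX sY _ Up.
have gPP : g p (P p) (P p) = 1 by exact: unitP.
have barE X' Y' : Dbar X' Y' p =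
    D X' Y' p + g p (Y' p) (P p) *: X' p - g p (X' p) (Y' p) *: P p by [].
rewrite /curvature (barE X (Dbar Y Z)) (barE Y (Dbar X Z)) (barE (lie X Y)).
rewrite (conn_semi_symmetric oU sX sY sZ Up) (conn_semi_symmetric oU sY sX sZ Up).
rewrite !barE -lieE /inner.
(* What remains is an identity between vectors of one tangent space, following from bilinearity and
   symmetry of [g] and [g(P, P) = 1]. *)
move: (D X (D Y Z) p) (D Y (D X Z) p) (D (lie X Y) Z p) => dxyz dyxz dlz.
move: (D X Y p) (D Y X p) (D X Z p) (D Y Z p) gPP => dxy dyx dxz dyz.
move: (X p) (Y p) (Z p) (P p) => x y z u gPP.
rewrite !metricBl !metricBr !metricDl !metricDr !metricZl !metricZr gPP.
rewrite [g p y x]metric_sym.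
apply/rowP => i; rewrite !mxE. by ring.
Qed.

(** In the trace of the curvature correction, the multiple of the identity contributes
    [n (pi(Y) pi(Z) - g(Y, Z))], while the terms along [Y] and along [P] each contribute
    [g(Y, Z) - pi(Y) pi(Z)]; hence the factor [n - 2]. *)
Lemma ricci_semi_symmetric U Y Z p : open U ->
  smooth_field U Y -> smooth_field U Z -> U p ->
  ricci Dbar Y Z p =
  ricci D Y Z p - (n%:R - 2) * (inner g Y Z p - inner g Y P p * inner g Z P p).
Proof.
(* [U] is cut down to the chart domain, where [extend p v] is known to be smooth. *)
move=> oU sY sZ Up; set c := chart_at p; pose V := U `&` dom c.
have oV : open V by apply: openI => //; exact: dom_open.
have Vp : V p by split=> //; exact: chart_at_dom.
have sY' : smooth_field V Y by apply: smooth_field_sub sY => q [].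
have sZ' : smooth_field V Z by apply: smooth_field_sub sZ => q [].
have sE v : smooth_field V (extend p v).
  by apply: smooth_field_sub (@smooth_extend _ _ _ p v) => q [].
set y := Y p; set z := Z p; set u := P p.
have guu : g p u u = 1 by exact: unitP.
rewrite !ricciE.
transitivity (\sum_(i < n) (curvature D (extend p (delta_mx 0 i)) Y Z p 0 i
    + (g p y u * g p z u - g p y z)
    + g p (delta_mx 0 i) z * y 0 i - g p z u * (g p (delta_mx 0 i) u * y 0 i)
    + g p y z * (g p (delta_mx 0 i) u * u 0 i)
    - g p y u * (g p (delta_mx 0 i) z * u 0 i))).
  apply: eq_bigr => i _.
  have := curvature_semi_symmetric oV (sE (delta_mx 0 i)) sY' sZ' Vp.
  rewrite /inner extend_at -/y -/z -/u => ->; rewrite !mxE !eqxx /=.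
  by ring.
rewrite !big_split /= !sumrN -!mulr_sumr !metric_trace !sumr_const card_ord guu.
rewrite [g p u z]metric_sym /inner -/y -/z -/u.
rewrite -[g p z u *+ n]mulr_natr -[g p y z *+ n]mulr_natr; ring.
Qed.

End SemiSymmetric.

(** * Consequences of the prescribed Ricci tensor under Ricci symmetry *)

Section ParallelUnitField.
Variables (R : realType) (n : nat) (M : manifold R n) (g : riemannian_metric M).
Variables (D : vfield M -> vfield M -> vfield M) (P : vfield M).
Hypothesis n_ge3 : (3 <= n)%N.
Hypothesis lcD : levi_civita g D.
Hypothesis smP : smooth_field [set: M] P.
Hypothesis unitP : forall p, inner g P P p = 1.
Hypothesis ricciD : forall (U : set M) (Y Z : vfield M), open U ->
  smooth_field U Y -> smooth_field U Z -> forall p : M, U p ->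
  ricci D Y Z p =
    (n%:R - 2) * inner g Y Z p - (n%:R - 2) * (inner g Y P p * inner g Z P p).

Lemma ricci_symmetric_parallel : ricci_symmetric D ->
  forall (U : set M) X p, open U -> smooth_field U X -> U p -> D X P p = 0.
Proof.
move=> ricS U X p oU sX Up; have [aD _ _] := lcD.
have sP : smooth_field U P := smooth_unit smP U.
have sDP : smooth_field U (D X P) by exact: (conn_smooth aD oU sX sP).
have sDD : smooth_field U (D X (D X P)) by exact: (conn_smooth aD oU sX sDP).
have ric0 Y q : smooth_field U Y -> U q -> ricci D Y P q = 0.
  by move=> sY Uq; rewrite (ricciD oU sY sP Uq) unitP mulr1 subrr.
(* Test [nabla S = 0] on the pair [D X P], [P]: two terms vanish by [ric0], and the third is [S(D_X
   P, D_X P) = (n - 2) g(D_X P, D_X P)], where [n - 2] is nonzero. *)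
have := ricS _ _ _ _ oU sX sDP sP _ Up; rewrite /cov_deriv2.
rewrite (act_cst X oU Up (fun q Uq => ric0 _ q sDP Uq)) (ric0 _ _ sDD Up).
rewrite (ricciD oU sDP sDP Up).
rewrite (unit_derivative_orthogonal lcD smP unitP oU sX Up) mul0r mulr0 !subr0 sub0r.
move=> /eqP; rewrite oppr_eq0 mulf_eq0 subr_eq0 eqr_nat (gtn_eqF n_ge3) /=.
by move=> /eqP /metric_eq0.
Qed.

(** The prescribed Ricci tensor is exactly the term subtracted in [ricci_semi_symmetric]. *)
Lemma ricci_symmetric_flat : ricci_symmetric D ->
  forall (U : set M) Y Z p, open U -> smooth_field U Y -> smooth_field U Z -> U p ->
  ricci (semi_symmetric g D P) Y Z p = 0.
Proof.
move=> /ricci_symmetric_parallel parP U Y Z p oU sY sZ Up.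
rewrite (ricci_semi_symmetric lcD smP unitP parP oU sY sZ Up).
by rewrite (ricciD oU sY sZ Up) mulrBr subrr.
Qed.

End ParallelUnitField.

Theorem theorem4p3 (R : realType) (n : nat) (hn : (3 <= n)%N)
  (M : manifold R n) (g : riemannian_metric M)
  (nabla : vfield M -> vfield M -> vfield M) (hnabla : levi_civita g nabla)
  (P : vfield M) (hP : smooth_field [set: M] P)
  (hP1 : forall p : M, Num.sqrt (inner g P P p) = 1)
  (hS : forall (U : set M) (Y Z : vfield M), open U ->
     smooth_field U Y -> smooth_field U Z -> forall p : M, U p ->
     ricci nabla Y Z p =
       (n%:R - 2) * inner g Y Z p - (n%:R - 2) * (inner g Y P p * inner g Z P p)) :
  ricci_symmetric nabla ->
  sym_ricci_symmetric (semi_symmetric g nabla P).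
Proof.
move=> ricS U X Y Z oU sX sY sZ p Up.
(* [Num.sqrt] is 0 on negative reals, so squaring needs [g(P, P)] to be nonnegative; this follows
   from the root being positive. *)
have unitP q : inner g P P q = 1.
  by rewrite -[LHS]sqr_sqrtr ?hP1 ?expr1n // ltW // -sqrtr_gt0 hP1.
have ric0 V W q : smooth_field U V -> smooth_field U W -> U q ->
    sym_ricci (semi_symmetric g nabla P) V W q = 0.
  move=> sV sW Uq; have flat := ricci_symmetric_flat hn hnabla hP unitP hS ricS oU.
  by rewrite /sym_ricci !flat // addr0 mulr0.
(* [ric0] asks for smooth arguments, and two terms of the covariant derivative have an argument
   differentiated by the semi-symmetric connection. *)
have sD := smooth_semi_symmetric hnabla hP oU.
rewrite /cov_deriv2 (act_cst X oU Up (fun q Uq => ric0 _ _ q sY sZ Uq)).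
rewrite (ric0 _ _ _ (sD _ _ sX sY) sZ Up) (ric0 _ _ _ sY (sD _ _ sX sZ) Up).
by rewrite !subr0.
Qed.
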